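(* Let $\mathcal{X}$ be a finite alphabet, let $u_1,\dots,u_k:\mathcal{X}\to\mathbb{R}$ and $a=(a_1,\dots,a_k)\in\mathbb{R}^k$, and let $\mathcal{Q}=\mathcal{L}(u,a)$ be the corresponding linear family. Let $p\in\mathcal{P}(\mathcal{X})$ be such that $S(p)=S(\mathcal{L}(u,a))$. Then the $L$-projection $\hat q$ of $p$ on $\mathcal{Q}$ is unique and belongs to the family $\varLambda(p,u,\theta,a)$; that is, $\mathcal{L}(u,a)\cap\varLambda(p,u,\theta,a)=\{\hat q\}$.
   Context: $\mathcal{P}(\mathcal{X})$ is the set of all probability mass functions on the finite set $\mathcal{X}$. The support of $p\in\mathcal{P}(\mathcal{X})$ is $S(p)=\{x:p(x)>0\}$. The support $S(\mathcal{C})$ of a convex set $\mathcal{C}\subset\mathcal{P}(\mathcal{X})$ is the support of the member of $\mathcal{C}$ whose support contains the support of any other member of $\mathcal{C}$. Linear family: $\mathcal{L}(u,a)=\{p\in\mathcal{P}(\mathcal{X}):\sum_{x\in\mathcal{X}}p(x)u_j(x)=a_j,\ j=1,\dots,k\}$. $\varLambda$-family: $\varLambda(\rho,u,\theta,a)$ is the set of all pmf's $q\in\mathcal{P}(\mathcal{X})$ of the form $q(x)=\rho(x)\big[1-\sum_{j=1}^k\theta_j(u_j(x)-a_j)\big]^{-1}$, $x\in\mathcal{X}$, where $\rho\in\mathcal{P}(\mathcal{X})$ is fixed and the parameters $\theta_1,\dots,\theta_k$ range over $\mathbb{R}$. For $p,q\in\mathcal{P}(\mathcal{X})$ the $L$-divergence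 is $L(q\|p)=\sum_{x\in\mathcal{X}}p(x)\log q(x)\in\mathbb{R}\cup\{-\infty\}$ (conventions $\log 0=-\infty$, $0\log 0=0$). The $L$-projection of $p$ on a set $\mathcal{Q}$ is $\hat q=\arg\sup_{q\in\mathcal{Q}}L(q\|p)$. *)

(* Defs.v *)
From HB Require Import structures.
From mathcomp Require Import all_boot all_order all_algebra.
From mathcomp Require Import all_classical all_reals all_analysis.

Set Implicit Arguments.
Unset Strict Implicit.
Unset Printing Implicit Defensive.

Import Order.TTheory GRing.Theory Num.Theory.

Local Open Scope classical_set_scope.
Local Open Scope ring_scope.

Section LProjection.
Context {R : realType} {X : finType}.

Definition prob_mass : set (X -> R) :=
  [set p | (forall x, 0 <= p x) /\ \sum_(x : X) p x = 1].

Definition supp (p : X -> R) : set X := [set x | 0 < p x].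

(* [is_family_supp C S] reads S(C) = S: a relation rather than a function, so
   that S(C) has no junk value when no member of C has the largest support
   (in particular when C is empty).  There is at most one such S. *)
Definition is_family_supp (C : set (X -> R)) (S : set X) : Prop :=
  exists2 q, C q & S = supp q /\ (forall q', C q' -> supp q' `<=` supp q).

Definition linear_family (k : nat) (u : 'I_k -> X -> R) (a : 'I_k -> R) :
    set (X -> R) :=
  [set p | prob_mass p /\ forall j : 'I_k, \sum_(x : X) p x * u j x = a j].

Definition Lambda_denom (k : nat) (u : 'I_k -> X -> R) (theta a : 'I_k -> R)
    (x : X) : R :=
  1 - \sum_(j < k) theta j * (u j x - a j).

(* Since 0^-1 = 0 here, the denominator is required to be nonzero at every x,
   including the points outside the support of rho. *)
Definition Lambda_family (rho : X -> R) (k : nat) (u : 'I_k -> X -> R)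
    (a : 'I_k -> R) : set (X -> R) :=
  [set q | prob_mass q /\ exists theta : 'I_k -> R, forall x,
     Lambda_denom u theta a x != 0 /\
     q x = rho x * (Lambda_denom u theta a x)^-1].

(* L(q || p): the weights come from the second argument p.  We have
   lne 0 = -oo and 0 * -oo = 0 in \bar R. *)
Definition Ldivergence (q p : X -> R) : \bar R :=
  (\sum_(x : X) (p x)%:E * lne (q x)%:E)%E.

(* The set of maximizers, i.e. arg sup over Q of L(q || p). *)
Definition Lprojections (Q : set (X -> R)) (p : X -> R) : set (X -> R) :=
  [set q | Q q /\
     Ldivergence q p = ereal_sup [set Ldivergence q' p | q' in Q]].

End LProjection.

(* Main.v *)
Require Import Defs.
From mathcomp Require Import all_boot all_order all_algebra.
From mathcomp Require Import all_classical all_reals all_analysis.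
From mathcomp Require Import ring lra.

Set Implicit Arguments.
Unset Strict Implicit.
Unset Printing Implicit Defensive.

Import Order.TTheory GRing.Theory Num.Theory numFieldNormedType.Exports.

Local Open Scope classical_set_scope.
Local Open Scope ring_scope.

(** Write g j x = u j x - a j for the centered constraints, so that the linear
    family is cut out by sum_x q x * g j x = 0, and S(p) for the common support.

    If q in the linear family has the form p / D with D = 1 - sum_j theta j * g j,
    then every q' in the linear family satisfies
    sum_x p x * (q' x / q x) = sum_x q' x * D x = 1 (Lambda_ratio_sum1). By
    ln s <= s - 1, with equality only at s = 1, this forces
    L(q' || p) < L(q || p) unless q' = q (Ldivergence_lt). So any member of the
    intersection of the two families is the unique L-projection, and the
    intersection has at most one element: only existence remains.

    For existence, a member q of the linear family maximizing L(q || p) is found by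
    compactness (exists_score_maximizer). It is positive on S(p), so it can be
    moved in both senses of any direction tangent to the constraints, and
    p / q - 1 is orthogonal to all these directions (first_order_le). By duality
    p / q - 1 is a combination of the g j on S(p) (exists_multipliers), which is
    the required form on S(p).

    Outside S(p) both p and q vanish, and the point is to keep the denominator
    nonzero there. Maximality of S(p) among the supports in the linear family
    implies that for x outside S(p) the vector (g j x)_j is not in the span of the
    vectors at the points of S(p) (exists_separating_direction). The multipliers
    can therefore be changed without effect on S(p) so that no denominator vanishes
    (exists_nonvanishing_shift, exists_Lambda_member). *)

(** * Linear duality and generic coefficients *)

(** The double-annihilator theorem for a finite system of functions on P:
    linear forms are represented by weights v supported in P. *)
Lemma span_on_of_orthogonal (F : fieldType) (X : finType) (k : nat)
    (P : pred X) (g : 'I_k -> X -> F) (f : X -> F) :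
  (forall v : X -> F, (forall x, ~~ P x -> v x = 0) ->
     (forall j, \sum_x v x * g j x = 0) -> \sum_x v x * f x = 0) ->
  exists c : 'I_k -> F, forall x, P x -> f x = \sum_j c j * g j x.
Proof.
move=> orth.
pose B : 'M[F]_(k, #|X|) :=
  \matrix_(j, i) (if P (enum_val i) then g j (enum_val i) else 0).
pose w : 'rV[F]_#|X| :=
  \row_i (if P (enum_val i) then f (enum_val i) else 0).
have : (w <= B)%MS.
  rewrite submxE; apply/eqP/rowP => c; rewrite !mxE.
  (* A row lies in the row space of B iff every column of cokermx B, itself
     killed by B, kills it: each column serves as a test function v. *)
  pose v x := if P x then cokermx B (enum_rank x) c else 0.
  have vB j : \sum_x v x * g j x = 0.
    have /matrixP/(_ j c) := mulmx_coker B; rewrite !mxE => {2}<-.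
    rewrite (reindex (@enum_val X predT)) /=; last first.
      by apply: onW_bij; exact: enum_val_bij.
    apply: eq_bigr => i _; rewrite mxE /v enum_valK.
    by case: ifP => _; rewrite ?mul0r // mulrC.
  rewrite -[RHS](orth v _ vB); last by move=> x /negbTE Px; rewrite /v Px.
  rewrite [RHS](reindex (@enum_val X predT)) /=; last first.
    by apply: onW_bij; exact: enum_val_bij.
  apply: eq_bigr => i _; rewrite mxE /v enum_valK.
  by case: ifP => _; rewrite ?mul0r // mulrC.
case/submxP => d wE; exists (fun j => d 0 j) => x Px.
have /rowP/(_ (enum_rank x)) := wE.
rewrite !mxE enum_rankK Px => ->; apply: eq_bigr => j _.
by rewrite mxE enum_rankK Px.
Qed.

Lemma exists_notin_seq (R : realDomainType) (s : seq R) : exists t, t \notin s.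
Proof.
pose M := \sum_(y <- s) `|y|; exists (1 + M); apply/negP => ins.
(* The norm of 1 + M is one term of the sum M. *)
suff : 1 + M <= M by rewrite gerDr ler10.
apply: le_trans (ler_norm _) _.
rewrite {2}/M (perm_big _ (perm_to_rem ins)) big_cons /= lerDl.
by apply: sumr_ge0.
Qed.

(** The coefficients that annihilate g on P form a space; when each point of s
    is separated from P by one of them, none of the finitely many affine
    conditions on s fills that space, so a single c avoids them all. *)
Lemma exists_nonvanishing_shift (R : realFieldType) (X : finType) (k : nat)
    (g : 'I_k -> X -> R) (P : pred X) (f : X -> R) (s : seq X) :
  (forall y, y \in s -> exists2 w : 'I_k -> R,
     (forall x, P x -> \sum_j w j * g j x = 0) & \sum_j w j * g j y != 0) ->
  exists2 c : 'I_k -> R,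
    (forall x, P x -> \sum_j c j * g j x = 0) &
    (forall y, y \in s -> f y + \sum_j c j * g j y != 0).
Proof.
elim: s => [|y s IHs] hs.
  by exists (fun=> 0) => // x _; rewrite big1 // => j _; rewrite mul0r.
have [z zs|c cP cs] := IHs; first by apply: hs; rewrite inE zs orbT.
have [|w wP wy] := hs y; first exact: mem_head.
pose G b x := \sum_j b j * g j x.
(* For a point z where w does not vanish, a single value of t is bad. *)
have [t tbad] := exists_notin_seq [seq - (f z + G c z) / G w z | z <- y :: s].
pose b j := c j + t * w j.
have GE x : G b x = G c x + t * G w x.
  rewrite /G mulr_sumr -big_split /=; apply: eq_bigr => j _.
  by rewrite /b mulrDl mulrA.
exists b => [x Px|z zys].
  by move: (GE x); rewrite /G => ->; rewrite cP // wP // mulr0 addr0.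
have -> : \sum_j b j * g j z = G c z + t * G w z by exact: GE.
have [Gw0|Gw0] := eqVneq (G w z) 0.
  rewrite Gw0 mulr0 addr0; apply: cs.
  move: zys; rewrite inE => /orP[/eqP zy|//].
  by move: wy; rewrite -zy -/(G w z) Gw0 eqxx.
apply: contraNneq tbad => e0; apply/mapP; exists z => //.
apply: (mulIf Gw0); rewrite mulfVK //; move: e0; rewrite addrA => e0.
by apply/eqP; rewrite -addr_eq0 addrC e0.
Qed.

(** * Elementary real analysis *)

Lemma nneg_eq0 (R : realDomainType) (y : R) : 0 <= y -> ~~ (0 < y) -> y = 0.
Proof. by move=> y0 ny; apply/eqP; rewrite eq_le y0 andbT leNgt. Qed.

Lemma le0_of_small_multiples (R : realType) (A C e0 : R) : 0 < e0 ->
  (forall e, 0 < e -> e <= e0 -> A <= e * C) -> A <= 0.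
Proof.
move=> e00 h; rewrite leNgt; apply/negP => A0.
have C0 : 0 < C by rewrite -(pmulr_rgt0 _ e00) (lt_le_trans A0) // h.
have AC : 0 < A / (2 * C) by rewrite divr_gt0 // mulr_gt0.
have : A <= Num.min e0 (A / (2 * C)) * C.
  by apply: h; rewrite ?ge_min ?lexx // lt_min e00.
apply/negP; rewrite -ltNge.
apply: (@le_lt_trans _ _ (A / (2 * C) * C)).
  by rewrite ler_pM2r // ge_min lexx orbT.
have -> : A / (2 * C) * C = A / 2 by field; rewrite gt_eqF.
by rewrite ltr_pdivrMr // ltr_pMr // ltr1n.
Qed.

Lemma ln_le_sub1 (R : realType) (s : R) : 0 < s -> ln s <= s - 1.
Proof.
by move=> s0; rewrite -{1}(subrK 1 s) addrC le_ln1Dx // ltrBrDl subrr.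
Qed.

Lemma ln_eq_sub1 (R : realType) (s : R) : 0 < s -> ln s = s - 1 -> s = 1.
Proof.
move=> s0 lns; apply/eqP; rewrite -subr_eq0; apply/negPn/negP.
move=> /expR_gt1Dx; rewrite -{2}lns lnK ?posrE // addrC subrK ltxx.
by [].
Qed.

(** Obtained from ln s <= s - 1 at s = (1 + t)^-1. *)
Lemma ln_ge_quadratic (R : realType) (t : R) :
  `|t| <= 2^-1 -> t - 2 * t ^+ 2 <= ln (1 + t).
Proof.
rewrite ler_norml => /andP[t1 t2].
have s0 : 0 < 1 + t by lra.
have le1 : - ln (1 + t) <= (1 + t)^-1 - 1.
  by rewrite -lnV ?posrE // ln_le_sub1 // invr_gt0.
suff : t - 2 * t ^+ 2 <= 1 - (1 + t)^-1 by lra.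
rewrite -(ler_pM2r s0) [leRHS]mulrBl mul1r mulVf ?gt_eqF //.
have : 0 <= t ^+ 2 * (1 + 2 * t) by rewrite mulr_ge0 ?sqr_ge0 //; lra.
by rewrite -subr_ge0 => h; rewrite -subr_ge0; congr (0 <= _) : h; ring.
Qed.

Lemma continuous_weighted_sum (R : realType) (X : finType)
    (T : topologicalType)
    (s : seq X) (w : X -> R) (F : X -> T -> R) (t : T) :
  (forall x, w x != 0 -> {for t, continuous (F x)}) ->
  {for t, continuous (fun z => \sum_(x <- s) w x * F x z)}.
Proof.
move=> cF; elim: s => [|x s IHs].
  have -> : (fun z => \sum_(x <- [::]) w x * F x z) = cst 0.
    by apply/funext => z; rewrite big_nil.
  exact: cst_continuous.
have -> : (fun z => \sum_(y <- x :: s) w y * F y z) =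
    (fun z => w x * F x z) \+ (fun z => \sum_(y <- s) w y * F y z).
  by apply/funext => z; rewrite big_cons.
apply: continuousD IHs; have [->|wx] := eqVneq (w x) 0.
  have -> : (fun z => 0 * F x z) = cst 0 by apply/funext => z; rewrite mul0r.
  exact: cst_continuous.
by apply: continuousM; [exact: cst_continuous|exact: cF].
Qed.

(** * Directions in a linear family and maximal support *)

Section Family.
Variables (R : realType) (X : finType) (k : nat).
Variables (u : 'I_k -> X -> R) (a : 'I_k -> R).
Implicit Types (p q r v : X -> R).

Lemma sum_centered v j :
  \sum_x v x * (u j x - a j) = \sum_x v x * u j x - (\sum_x v x) * a j.
Proof.
rewrite mulr_suml -sumrB; apply: eq_bigr => x _; exact: mulrBr.
Qed.

Lemma linear_family_centered q j :
  linear_family u a q -> \sum_x q x * (u j x - a j) = 0.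
Proof. by case=> -[_ q1] qu; rewrite sum_centered q1 qu mul1r subrr. Qed.

(** Centering the constraints makes them homogeneous, so the family is
    a slice of a cone and perturbations need not preserve total mass. *)
Lemma linear_family_normalize r :
  (forall x, 0 <= r x) -> 0 < \sum_x r x ->
  (forall j, \sum_x r x * (u j x - a j) = 0) ->
  linear_family u a (fun x => r x / \sum_y r y).
Proof.
move=> r0 M0 ru; split; first split.
- by move=> x; rewrite divr_ge0 // ltW.
- by rewrite -mulr_suml divff // gt_eqF.
- move=> j; have /eqP := ru j; rewrite sum_centered subr_eq0 => /eqP ruj.
  under eq_bigr do rewrite mulrAC.
  by rewrite -mulr_suml ruj mulrAC divff ?mul1r // gt_eqF.
Qed.

(** Perturbing q by e v multiplies q x by 1 + e (v x / q x), so for small e it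
    stays positive wherever q is. *)
Lemma exists_relative_step q v : (forall x, 0 <= q x) ->
  exists2 e0 : R, 0 < e0 & forall e x, 0 < e -> e <= e0 -> 0 < q x ->
    `|e * (v x / q x)| <= 2^-1.
Proof.
move=> q0; pose M := 1 + \sum_x `|v x / q x|.
have M0 : 0 < M by rewrite ltr_pwDl // sumr_ge0.
exists (2 * M)^-1 => [|e x e0 ele qx0]; first by rewrite invr_gt0 mulr_gt0.
rewrite normrM gtr0_norm //.
have leM : `|v x / q x| <= M.
  rewrite /M (bigD1 x) //= addrCA lerDl addr_ge0 // sumr_ge0 //.
apply: le_trans (ler_pM (ltW e0) (normr_ge0 _) ele leM) _.
by rewrite invfM mulfVK // gt_eqF.
Qed.

(** A positive v x would let q move along v to a member of the family charging
    x, against the maximality of the support of q. *)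
Lemma maximal_supp_direction q v x :
  linear_family u a q ->
  (forall q', linear_family u a q' -> supp q' `<=` supp q) ->
  ~~ (0 < q x) ->
  (forall y, ~~ ((0 < q y) || (y == x)) -> v y = 0) ->
  (forall j, \sum_y v y * (u j y - a j) = 0) -> v x <= 0.
Proof.
move=> Lq qmax qx vout vg; rewrite leNgt; apply/negP => vx.
have q0 : forall y, 0 <= q y by case: Lq => -[].
have [e e0 he] := exists_relative_step v q0.
pose r y := q y + e * v y.
have r0 y : 0 <= r y.
  have [qy|qy] := boolP (0 < q y).
    have := he e y e0 (lexx _) qy; rewrite ler_norml => /andP[h _].
    have -> : r y = q y * (1 + e * (v y / q y)).
      by rewrite /r; field; rewrite gt_eqF.
    by rewrite mulr_ge0 //; lra.
  have [->|yx] := eqVneq y x; first by rewrite addr_ge0 // mulr_ge0 // ltW.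
  by rewrite /r vout ?mulr0 ?addr0 // negb_or qy.
have rx : 0 < r x by rewrite ltr_wpDl // mulr_gt0.
have M0 : 0 < \sum_y r y.
  by rewrite (bigD1 x) //= ltr_pwDl // sumr_ge0.
(* Normalizing r gives a member of the family charging x. *)
have : supp q x.
  apply: (qmax _ (linear_family_normalize r0 M0 _)) => [j|].
    under eq_bigr do rewrite mulrDl -mulrA.
    by rewrite big_split /= -mulr_sumr vg linear_family_centered // mulr0 addr0.
  by rewrite /supp /= divr_gt0.
by rewrite /supp /= (negbTE qx).
Qed.

(** By the preceding lemma for v and for - v, every relation among the centered
    constraints at x and at the points of S(q) has coefficient 0 at x; hence the
    constraint vector at x is outside the span of those on S(q), and some linear
    form vanishes on that span but not at x. *)
Lemma exists_separating_direction q x :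
  linear_family u a q ->
  (forall q', linear_family u a q' -> supp q' `<=` supp q) ->
  ~~ (0 < q x) ->
  exists2 w : 'I_k -> R,
    (forall y, 0 < q y -> \sum_j w j * (u j y - a j) = 0) &
    \sum_j w j * (u j x - a j) != 0.
Proof.
move=> Lq qmax qx.
(* The required w expresses the indicator of x on S(q) and x. *)
have [v vout vg|w wE] := @span_on_of_orthogonal R X k
    (fun y => (0 < q y) || (y == x)) (fun j y => u j y - a j)
    (fun y => (y == x)%:R).
  rewrite (bigD1 x) //= eqxx mulr1 big1 ?addr0; last first.
    by move=> y /negbTE ->; rewrite mulr0.
  apply/eqP; rewrite eq_le (@maximal_supp_direction q) //=.
  rewrite -oppr_le0 (@maximal_supp_direction q (fun y => - v y)) //.
    by move=> y /vout ->; rewrite oppr0.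
  by move=> j; under eq_bigr do rewrite mulNr; rewrite sumrN vg oppr0.
exists w => [y qy|].
  by rewrite -wE ?qy //; case: eqP => // yx; rewrite -yx qy in qx.
by rewrite -wE ?eqxx ?orbT // oner_eq0.
Qed.

(** * Existence of a maximizer *)

(** The real-valued L(q || p), meaningful when q is positive on S(p); elsewhere
    ln 0 = 0 makes it differ from the divergence. *)
Definition log_score p q : R := \sum_x p x * ln (q x).

Lemma prob_mass_le1 q x : prob_mass q -> q x <= 1.
Proof.
by case=> q0 <-; rewrite (bigD1 x) //= lerDl sumr_ge0.
Qed.

(** A closed subset of the cube [0, 1]^X. *)
Lemma compact_linear_family_ge (d : X -> R) :
  compact ([set q : {ptws X -> R} |
     linear_family u a q /\ forall x, d x <= q x]).
Proof.
have coord x : continuous (fun q : {ptws X -> R} => q x).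
  exact: (@proj_continuous X (fun=> R) x).
have coordsum w : continuous (fun q : {ptws X -> R} => \sum_x w x * q x).
  by move=> q; apply: continuous_weighted_sum => x _; exact: coord.
rewrite (_ : [set _ | _] =
  [set q : {ptws X -> R} | forall x, `[0, 1]%classic (q x)] `&`
  ((\bigcap_(x in setT) [set q : {ptws X -> R} | d x <= q x]) `&`
  ([set q | \sum_x 1 * q x = 1] `&`
   (\bigcap_(j in setT) [set q | \sum_x u j x * q x = a j])))).
  apply: compact_closedI.
    exact: (@tychonoff X (fun=> R) (fun=> `[0, 1]%classic)
      (fun=> @segment_compact R 0 1)).
  apply: closedI.
    apply: closed_bigI => x _.
    apply: (@preimage_closed _ _ (fun q : {ptws X -> R} => q x)
      [set y | d x <= y]).
      by move=> q _; exact: coord.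
    exact: closed_ge.
  apply: closedI.
    apply: (@preimage_closed _ _ (fun q : {ptws X -> R} => \sum_x 1 * q x)
      [set y | y = 1]).
      by move=> q _; exact: coordsum.
    exact: closed_eq.
  apply: closed_bigI => j _.
  apply: (@preimage_closed _ _ (fun q : {ptws X -> R} => \sum_x u j x * q x)
    [set y | y = a j]).
    by move=> q _; exact: coordsum.
  exact: closed_eq.
apply/seteqP; split=> q /=.
  move=> [[qp qu] qd]; split; last split; last split.
  - by move=> x; rewrite in_itv /= prob_mass_le1 // andbT; case: qp.
  - by move=> x _; exact: qd.
  - by under eq_bigr do rewrite mul1r; case: qp.
  - by move=> j _ /=; rewrite -qu; apply: eq_bigr => x _; rewrite mulrC.
move=> [q01 [qd [q1 qu]]]; split; last by move=> x; exact: qd.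
split; first split.
- by move=> x; have := q01 x; rewrite in_itv /= => /andP[].
- by rewrite -q1; apply: eq_bigr => x _; rewrite mul1r.
- by move=> j; rewrite -(qu j I); apply: eq_bigr => x _; rewrite mulrC.
Qed.

(** The score is not continuous at the boundary, but since the logarithm of a
    probability is nonpositive, a member scoring at least c satisfies
    p x * ln (q x) >= c at each x, hence q x >= expR (c / p x) on S(p). The
    maximum may thus be sought on a compact set on which ln is continuous. *)
Lemma exists_score_maximizer p q0 :
  (forall x, 0 <= p x) ->
  linear_family u a q0 -> (forall x, 0 < p x -> 0 < q0 x) ->
  exists2 q, linear_family u a q /\ (forall x, 0 < p x -> 0 < q x) &
    forall q', linear_family u a q' -> (forall x, 0 < p x -> 0 < q' x) ->
      log_score p q' <= log_score p q.
Proof.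
move=> p0 Lq0 q0pos.
pose c := log_score p q0.
pose d x := if 0 < p x then expR (c / p x) else 0.
pose K := [set q : {ptws X -> R} | linear_family u a q /\ forall x, d x <= q x].
have Kpos q : K q -> forall x, 0 < p x -> 0 < q x.
  move=> [_ qd] x px; apply: lt_le_trans (qd x).
  by rewrite /d px expR_gt0.
have inK q : linear_family u a q -> (forall x, 0 < p x -> 0 < q x) ->
    c <= log_score p q -> K q.
  move=> Lq qpos cq; have qprob : prob_mass q by case: Lq.
  split=> // x; rewrite /d; case: ifPn => px; last by case: qprob.
  rewrite -[q x]lnK ?posrE ?qpos // ler_expR ler_pdivrMr // mulrC.
  apply: (le_trans cq); rewrite /log_score (bigD1 x) //= gerDl.
  apply: sumr_le0 => y _; apply: mulr_ge0_le0 => //.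
  by apply: ln_le0; exact: prob_mass_le1.
have K0 : K q0 by exact: inK.
have [|||q] := @compact_EVT_max {ptws X -> R} R (log_score p) K.
- by exists q0.
- exact: compact_linear_family_ge.
- apply: continuous_in_subspaceT => q /set_mem Kq.
  apply: continuous_weighted_sum => x px.
  apply: (@continuous_comp _ _ _ (fun q : {ptws X -> R} => q x) (@ln R)).
    exact: (@proj_continuous X (fun=> R) x).
  by apply: continuous_ln; apply: Kpos => //; rewrite lt_neqAle eq_sym px p0.
move=> /set_mem Kq qmax; exists q; first by split; [case: Kq | exact: Kpos].
move=> q' Lq' q'pos; have [cq'|q'c] := leP c (log_score p q').
  by apply/qmax/mem_set; exact: inK.
by apply: le_trans (ltW q'c) _; apply/qmax/mem_set.
Qed.

(** * First-order condition and multipliers *)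

(** The derivative of the score of the normalized q + e v at e = 0 is the left
    side. The quadratic lower bound on ln replaces differentiation. *)
Lemma first_order_le p q v :
  prob_mass p -> (forall x, 0 < q x -> 0 < p x) ->
  (forall x, 0 < p x -> 0 < q x) ->
  linear_family u a q ->
  (forall q', linear_family u a q' -> (forall x, 0 < p x -> 0 < q' x) ->
     log_score p q' <= log_score p q) ->
  (forall x, ~~ (0 < q x) -> v x = 0) ->
  (forall j, \sum_x v x * (u j x - a j) = 0) ->
  \sum_x v x * (p x / q x - 1) <= 0.
Proof.
move=> [p0 p1] qp pq Lq qmax vout vg.
have q0 : forall x, 0 <= q x by case: Lq => -[].
have q1 : \sum_x q x = 1 by case: Lq => -[].
have [e0 e00 he] := exists_relative_step v q0.
apply: (@le0_of_small_multiples _ _ (2 * \sum_x p x * (v x / q x) ^+ 2) e0) => //.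
move=> e ep ele.
pose t x := e * (v x / q x).
pose r x := q x + e * v x.
have rE x : r x = q x * (1 + t x).
  rewrite /r /t; have [qx|qx] := boolP (0 < q x).
    by field; rewrite gt_eqF.
  by rewrite (vout _ qx) mul0r !mulr0 !addr0 mulr1.
have t0 x : 0 < 1 + t x.
  have [qx|qx] := boolP (0 < q x).
    by have := he e x ep ele qx; rewrite ler_norml /t => /andP[h _]; lra.
  by rewrite /t (vout _ qx) mul0r mulr0 addr0.
have r0 x : 0 <= r x by rewrite rE mulr_ge0 // ltW.
have rpos x : 0 < p x -> 0 < r x by move=> px; rewrite rE mulr_gt0 // pq.
(* The moved point r = q + e v has mass 1 + e (sum of v), so it is normalized
   before it is compared with q. *)
have ME : \sum_x r x = 1 + e * \sum_x v x.
  by rewrite big_split /= q1 -mulr_sumr.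
have M0 : 0 < \sum_x r x.
  rewrite lt_neqAle sumr_ge0 // andbT eq_sym; apply/eqP => /psumr_eq0P h.
  have : \sum_x p x = 0.
    apply: big1 => x _; apply/eqP; rewrite eq_le p0 andbT leNgt.
    by apply/negP => /rpos; rewrite h ?ltxx.
  by rewrite p1 => /eqP; rewrite oner_eq0.
have rg j : \sum_x r x * (u j x - a j) = 0.
  under eq_bigr do rewrite mulrDl -mulrA.
  by rewrite big_split /= -mulr_sumr vg linear_family_centered // mulr0 addr0.
have rMpos x : 0 < p x -> 0 < r x / \sum_y r y.
  by move=> px; rewrite divr_gt0 // rpos.
have := qmax _ (linear_family_normalize r0 M0 rg) rMpos.
have lnM_le : ln (\sum_x r x) <= e * \sum_x v x.
  by rewrite ME in M0 *; apply: le_ln1Dx; lra.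
have scoreE : log_score p (fun x => r x / \sum_y r y) =
    log_score p q + \sum_x p x * ln (1 + t x) - ln (\sum_x r x).
  have -> : ln (\sum_x r x) = \sum_x p x * ln (\sum_y r y).
    by rewrite -mulr_suml p1 mul1r.
  rewrite /log_score -big_split -sumrB /=; apply: eq_bigr => x _.
  have [px|px] := boolP (0 < p x).
    rewrite lnM ?posrE ?rpos ?invr_gt0 // lnV ?posrE // rE.
    by rewrite lnM ?posrE ?pq //; ring.
  by rewrite (nneg_eq0 (p0 x) px) !mul0r addr0 subr0.
rewrite scoreE => le_score.
have quad : \sum_x p x * (t x - 2 * t x ^+ 2) <= \sum_x p x * ln (1 + t x).
  apply: ler_sum => x _; apply: ler_wpM2l => //; apply: ln_ge_quadratic.
  have [qx|qx] := boolP (0 < q x); first exact: he.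
  by rewrite /t (vout _ qx) mul0r mulr0 normr0 invr_ge0.
have quadE : \sum_x p x * (t x - 2 * t x ^+ 2) =
    e * \sum_x p x * (v x / q x) -
    e ^+ 2 * (2 * \sum_x p x * (v x / q x) ^+ 2).
  by rewrite !mulr_sumr -sumrB; apply: eq_bigr => x _; rewrite /t; ring.
have -> : \sum_x v x * (p x / q x - 1) =
    \sum_x p x * (v x / q x) - \sum_x v x.
  by rewrite -sumrB; apply: eq_bigr => x _; ring.
rewrite -(ler_pM2l ep) mulrBr.
by rewrite mulrA -expr2; lra.
Qed.

(** Lagrange multipliers: the first-order condition for v and - v says that
    p / q - 1 is orthogonal to everything orthogonal to the centered
    constraints on S(q). *)
Lemma exists_multipliers p q :
  prob_mass p -> (forall x, 0 < q x -> 0 < p x) ->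
  (forall x, 0 < p x -> 0 < q x) ->
  linear_family u a q ->
  (forall q', linear_family u a q' -> (forall x, 0 < p x -> 0 < q' x) ->
     log_score p q' <= log_score p q) ->
  exists b : 'I_k -> R, forall x, 0 < q x ->
    p x / q x - 1 = \sum_j b j * (u j x - a j).
Proof.
move=> pp qp pq Lq qmax.
apply: (@span_on_of_orthogonal R X k (fun x => 0 < q x)
  (fun j x => u j x - a j) (fun x => p x / q x - 1)) => v vout vg.
apply/eqP; rewrite eq_le first_order_le //=.
rewrite -oppr_le0 -sumrN; under eq_bigr do rewrite -mulNr.
apply: first_order_le => //.
  by move=> x /vout ->; rewrite oppr0.
by move=> j; under eq_bigr do rewrite mulNr; rewrite sumrN vg oppr0.
Qed.

(** * Strict optimality of members of the Lambda-family *)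

Lemma Ldivergence_EFin p q : (forall x, 0 <= p x) ->
  (forall x, 0 < p x -> 0 < q x) -> Ldivergence q p = (log_score p q)%:E.
Proof.
move=> p0 qpos; rewrite /Ldivergence /log_score -sumEFin.
apply: eq_bigr => x _; have [px|px] := boolP (0 < p x).
  by rewrite lne_EFin ?qpos // EFinM.
by rewrite (nneg_eq0 (p0 x) px) mul0e mul0r.
Qed.

Lemma Ldivergence_Ny p q x : 0 < p x -> q x <= 0 -> Ldivergence q p = -oo%E.
Proof.
move=> px qx; apply/esum_eqNyP; exists x; split => //.
by rewrite le0_lneNy ?lee_fin // gt0_muleNy ?lte_fin.
Qed.

(** Jensen inequality for the concave ln, in the form ln s <= s - 1 with equality
    only at s = 1, applied to s = q' x / q x. *)
Lemma Ldivergence_lt p q q' :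
  prob_mass p -> prob_mass q' ->
  (forall x, 0 < p x -> 0 < q x) ->
  (forall x, ~~ (0 < p x) -> q' x = q x) ->
  \sum_x p x * (q' x / q x) = 1 ->
  q' <> q -> (Ldivergence q' p < Ldivergence q p)%E.
Proof.
move=> [p0 p1] [q'0 _] qpos out sum1 neq.
rewrite (Ldivergence_EFin p0 qpos).
have [/forallP pos|] := boolP [forall x, (0 < p x) ==> (0 < q' x)]; last first.
  rewrite negb_forall => /existsP[x]; rewrite negb_imply -leNgt => /andP[px q'x].
  by rewrite (Ldivergence_Ny px q'x) ltNyr.
have q'pos x : 0 < p x -> 0 < q' x by exact/implyP.
rewrite (Ldivergence_EFin p0 q'pos) lte_fin.
pose gap x := p x * (q' x / q x - 1 - ln (q' x / q x)).
have gap0 x : 0 <= gap x.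
  have [px|px] := boolP (0 < p x).
    by rewrite mulr_ge0 // subr_ge0 ln_le_sub1 // divr_gt0 ?q'pos ?qpos.
  by rewrite /gap (nneg_eq0 (p0 x) px) mul0r.
have gapE : \sum_x gap x = log_score p q - log_score p q'.
  have -> : log_score p q - log_score p q' = \sum_x p x * (q' x / q x) -
      \sum_x p x + (log_score p q - log_score p q') by rewrite sum1 p1; ring.
  rewrite /log_score -!sumrB -big_split /=.
  apply: eq_bigr => x _; rewrite /gap; have [px|px] := boolP (0 < p x).
    by rewrite ln_div ?posrE ?q'pos ?qpos //; ring.
  by rewrite (nneg_eq0 (p0 x) px) !mul0r !subr0 addr0.
rewrite -subr_gt0 -gapE lt_neqAle sumr_ge0 ?andbT; last by move=> x _.
rewrite eq_sym; apply/eqP => /psumr_eq0P gap_eq0.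
apply: neq; apply/funext => x; have [px|] := boolP (0 < p x); last exact: out.
have /eqP := gap_eq0 (fun x _ => gap0 x) x isT.
rewrite mulf_eq0 gt_eqF //= subr_eq0 eq_sym => /eqP.
move=> /(ln_eq_sub1 (divr_gt0 (q'pos _ px) (qpos _ px))) /divr1_eq; exact.
Qed.

(** On S(p) the ratio p / q is the denominator, whose average under any member of
    the linear family is 1 because the centered constraints average to 0. Positivity
    of q on S(p) follows from the nonvanishing of the denominator. *)
Lemma Lambda_ratio_sum1 p q q' :
  prob_mass p ->
  linear_family u a q -> Lambda_family p u a q -> linear_family u a q' ->
  (forall x, ~~ (0 < p x) -> q' x = 0) ->
  (forall x, 0 < p x -> 0 < q x) /\ \sum_x p x * (q' x / q x) = 1.
Proof.
move=> [p0 p1] [[q0 q1] _] [_ [theta qE]] Lq' out.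
have qpos x : 0 < p x -> 0 < q x.
  move=> px; rewrite lt_neqAle q0 andbT eq_sym.
  by have [D0 ->] := qE x; rewrite mulf_neq0 ?invr_eq0 // gt_eqF.
split=> //.
transitivity (\sum_x q' x * Lambda_denom u theta a x).
  apply: eq_bigr => x _; have [px|px] := boolP (0 < p x).
    by have [D0 ->] := qE x; field; rewrite D0 gt_eqF.
  by rewrite out // !mul0r mulr0.
under eq_bigr do rewrite mulrBr mulr1.
rewrite sumrB; have [[_ ->] _] := Lq'.
rewrite [X in 1 - X](_ : _ = 0) ?subr0 //.
under eq_bigr do rewrite mulr_sumr.
rewrite exchange_big big1 //= => j _.
under eq_bigr do rewrite mulrCA.
by rewrite -mulr_sumr linear_family_centered // mulr0.
Qed.

(** * The projection *)

(** The maximizer of the score has the right form on S(p) by its multipliers. At a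
    point outside S(p) both p and q vanish, but the denominator might vanish too:
    a correction of the multipliers invisible on S(p) prevents it. *)
Lemma exists_Lambda_member p :
  prob_mass p -> is_family_supp (linear_family u a) (supp p) ->
  exists q, (linear_family u a `&` Lambda_family p u a) q.
Proof.
move=> pp [q1 Lq1 [suppE suppmax]].
have [p0 _] := pp.
have q1pos x : 0 < p x -> 0 < q1 x.
  by move=> px; have : supp p x := px; rewrite suppE.
have [q [Lq qpos] qmax] := exists_score_maximizer p0 Lq1 q1pos.
have qp x : 0 < q x -> 0 < p x.
  by move=> qx; have := suppmax q Lq x qx; rewrite -suppE.
have maxq q' : linear_family u a q' -> supp q' `<=` supp q.
  by move=> /suppmax h x /h; rewrite -suppE => /qpos.
have [b bE] := exists_multipliers pp qp qpos Lq qmax.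
(* Correcting b by c fixes the denominator off S(p) and keeps it on S(p). *)
have [y|c cS coff] := @exists_nonvanishing_shift R X k
    (fun j x => u j x - a j) (fun x => 0 < q x)
    (fun x => 1 + \sum_j b j * (u j x - a j)) [seq x <- enum X | ~~ (0 < q x)].
  rewrite mem_filter => /andP[qy _].
  exact: exists_separating_direction Lq maxq qy.
have DE x : Lambda_denom u (fun j => - (b j + c j)) a x =
    1 + \sum_j b j * (u j x - a j) + \sum_j c j * (u j x - a j).
  rewrite /Lambda_denom -addrA -big_split -sumrN; congr (_ + _).
  by apply: eq_bigr => j _ /=; ring.
exists q; split => //; split; first by case: Lq.
exists (fun j => - (b j + c j)) => x; rewrite DE.
have [qx|qx] := boolP (0 < q x).
  rewrite cS // addr0 -bE // addrC subrK; have px := qp _ qx.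
  split; first by rewrite mulf_neq0 ?invr_eq0 // gt_eqF.
  by rewrite invf_div mulrCA divff ?mulr1 // gt_eqF.
split; first by apply: coff; rewrite mem_filter qx mem_enum.
have px : ~~ (0 < p x) by apply: contra qx => /qpos.
have [[q0 _] _] := Lq.
by rewrite (nneg_eq0 (p0 x) px) mul0r (nneg_eq0 (q0 x) qx).
Qed.

End Family.

Theorem mainTheorem4 (R : realType) (X : finType) (k : nat)
    (u : 'I_k -> X -> R) (a : 'I_k -> R) (p : X -> R)
    (hp : prob_mass p)
    (hS : is_family_supp (linear_family u a) (supp p)) :
  exists qhat : X -> R,
    Lprojections (linear_family u a) p = [set qhat] /\
    linear_family u a `&` Lambda_family p u a = [set qhat].
Proof.
have out q' : linear_family u a q' -> forall x, ~~ (0 < p x) -> q' x = 0.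
  move=> Lq' x px; case: hS => q1 _ [suppE /(_ _ Lq')]; rewrite -suppE => sub.
  have [[q'0 _] _] := Lq'; apply: nneg_eq0 => //.
  by apply: contra px => /sub.
have lt_of q q' : linear_family u a q -> Lambda_family p u a q ->
    linear_family u a q' -> q' <> q -> (Ldivergence q' p < Ldivergence q p)%E.
  move=> Lq Cq Lq'; have [qpos sum1] := Lambda_ratio_sum1 hp Lq Cq Lq' (out _ Lq').
  apply: Ldivergence_lt => //; first by case: Lq'.
  by move=> x px; rewrite (out _ Lq' x px) (out _ Lq x px).
have [q [Lq Cq]] := exists_Lambda_member hp hS.
exists q; split; apply/seteqP; split => q'.
- move=> [Lq' q'sup] /=; apply: contrapT => /(lt_of _ _ Lq Cq Lq').
  by apply/negP; rewrite -leNgt q'sup; apply: ereal_sup_ubound; exists q.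
- move=> ->; split => //; apply/eqP; rewrite eq_le; apply/andP; split.
    by apply: ereal_sup_ubound; exists q.
  apply: ge_ereal_sup => _ [q'' Lq'' <-].
  have [->//|/eqP neq] := eqVneq q'' q; exact/ltW/lt_of.
- move=> [Lq' Cq'] /=; apply: contrapT => neq.
  have := lt_of _ _ Lq Cq Lq' neq.
  by rewrite ltNge (ltW (lt_of _ _ Lq' Cq' Lq (nesym neq))).
- by move=> ->.
Qed.
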